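(* In the setting of the context (in particular with continuous $c$, weakly continuous $p$, the Lipschitz bounds with constants $\tilde L_1,\tilde K_1$, and $\beta\tilde K_1<1$), for each $T$ let $(\tilde\pi^T_t,\tilde\mu^T_t)_{t\ge0}$ be an extended mean-field equilibrium of the $T$-horizon game. Suppose that, as $T\to\infty$, $(\tilde\pi^T_t\otimes\tilde\mu^T_t)_{t\ge0}$ converges in $\prod_{t\ge0}\mathcal P(X\times A)$ (product of weak topologies) to $(\hat\pi_t\otimes\hat\mu_t)_{t\ge0}$, where $(\hat\pi_t,\hat\mu_t)_{t\ge0}$ is an asymptotically discount optimal mean-field equilibrium. Then for every $\varepsilon>0$ there exist $\tilde t(\varepsilon)$, $\tilde T=\tilde T(\tilde t(\varepsilon))$ and $T(\varepsilon)$ such that $$W_1\left(\tilde\pi^{\tilde T}_{\tilde t(\varepsilon)}\otimes\tilde\mu^{\tilde T}_{\tilde t(\varepsilon)},\ \hat\pi_t\otimes\hat\mu_t\right)<\varepsilon\qquad\text{for all }t\ge T(\varepsilon).$$ In particular, the tail of $(\hat\pi_t\otimes\hat\mu_t)_{t\ge0}$ can be approximated uniformly in $t$ by elements of the extended equilibria $\{(\tilde\pi^T_t,\tilde\mu^T_t)_{t\ge0}:T\in\mathbb N\}$.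
   Context: $(X,d_X)$ is a compact metric space, $A$ a compact convex subset of some $\mathbb R^m$, $\beta\in[0,1)$, $c:X\times A\times\mathcal P(X)\to\mathbb R$, $p:X\times A\times\mathcal P(X)\to\mathcal P(X)$, $\mu_0\in\mathcal P(X)$. $W_1$ is the 1-Wasserstein metric, which metrizes weak convergence on $\mathcal P(X)$ and on $\mathcal P(X\times A)$. Assumptions: (i) if $(x_n,a_n,\mu_n)\to(x,a,\mu)$ in $X\times A\times\mathcal P(X)$, then $c(x_n,a_n,\mu_n)\to c(x,a,\mu)$ and $p(\cdot|x_n,a_n,\mu_n)\to p(\cdot|x,a,\mu)$ weakly; (ii) for all $x,\hat x,a,\mu$: $|c(x,a,\mu)-c(\hat x,a,\mu)|\le\tilde L_1d_X(x,\hat x)$ and $W_1(p(\cdot|x,a,\mu),p(\cdot|\hat x,a,\mu))\le\tilde K_1d_X(x,\hat x)$; (iii) $\beta\tilde K_1<1$. A policy is a stochastic kernel $\pi:X\to\mathcal P(A)$; $\pi\otimes\mu(da,dx):=\pi(da|x)\mu(dx)$. A mean-field equilibrium of the $T$-horizon game $(X,A,c,p,\mu_0,T)$ is a pair of flows $(\pi^T_t)_{t=0}^{T-1}$, $(\mu^T_t)_{t=0}^{T-1}$ with $\mu^T_0=\mu_0$ such that (1) $(\pi^T_t)_t$ minimizes $E[\sum_{t=0}^{T-1}\beta^tc(x_t,a_t,\mu^T_t)]$ over Markov policies, where $x_0\sim\mu_0$, $a_t\sim\pi_t(\cdot|x_t)$, $x_{t+1}\sim p(\cdot|x_t,a_t,\mu^T_t)$,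 and (2) $\mu^T_{t+1}(\cdot)=\int_X\int_A p(\cdot|x,a,\mu^T_t)\pi^T_t(da|x)\mu^T_t(dx)$. A mean-field equilibrium of the infinite-horizon non-stationary game $(X,A,c,p,\mu_0)$ is the analogous pair $((\pi_t)_{t\ge0},(\mu_t)_{t\ge0})$ with $T$ replaced by $\infty$. A mean-field equilibrium of the stationary game $(X,A,c,p)$ is a pair $(\pi,\mu)$ such that the constant flows $(\pi,\pi,\dots),(\mu,\mu,\dots)$ form a mean-field equilibrium of the non-stationary game with initial measure $\mu$. The extended mean-field equilibrium associated with a $T$-horizon equilibrium is $(\tilde\pi^T_t,\tilde\mu^T_t)=(\pi^T_t,\mu^T_t)$ for $t\le T-1$ and $(\pi^T_{T-1},\mu^T_{T-1})$ for $t\ge T$. An asymptotically discount optimal mean-field equilibrium is a mean-field equilibrium $(\hat\pi_t,\hat\mu_t)_{t\ge0}$ of the non-stationary game such that $\lim_{t\to\infty}\hat\pi_t\otimes\hat\mu_t=\pi\otimes\mu$ exists in $(\mathcal P(X\times A),W_1)$ for some mean-field equilibrium $(\pi,\mu)$ of the stationary game. *)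

(* Defs.v *)
From HB Require Import structures.
From mathcomp Require Import all_boot all_order all_algebra.
From mathcomp Require Import all_classical all_reals all_analysis.

Set Implicit Arguments.
Unset Strict Implicit.
Unset Printing Implicit Defensive.

Import Order.TTheory GRing.Theory Num.Theory.
Import numFieldNormedType.Exports.

Local Open Scope classical_set_scope.
Local Open Scope ring_scope.

(* The two structures are unrelated here; [borel_space] relates them. *)
#[short(type="metricMeasurableType")]
HB.structure Definition MetricMeasurable (d : measure_display)
    (R : numDomainType) := {T of Metric R T & Measurable d T}.

Definition borel_space d (R : realType) (T : metricMeasurableType d R) : Prop :=
  (measurable : set (set T)) = <<s (open : set (set T)) >>.

(* The library equips a product with the balls of the maximum of the two
   distances, so [mdist] has to be that maximum. *)
Section product_metric.
Context (R : realFieldType) (T U : metricType R).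

Definition prod_mdist (x y : T * U) : R :=
  Num.max (mdist x.1 y.1) (mdist x.2 y.2).

Let prod_mdist_ge0 x y : 0 <= prod_mdist x y.
Proof. by rewrite le_max mdist_ge0. Qed.

Let prod_mdist_positivity x y : prod_mdist x y = 0 -> x = y.
Proof.
case: x y => [x1 x2] [y1 y2] /eqP; rewrite eq_le => /andP[+ _].
rewrite ge_max /= => /andP[le1 le2].
by congr (_, _); apply: mdist_positivity; apply/eqP;
  rewrite eq_le mdist_ge0 ?le1 ?le2.
Qed.

Let prod_ballEmdist (x : T * U) e : ball x e = [set y | prod_mdist x y < e].
Proof.
apply/seteqP; split => y; rewrite /ball/= /prod_ball !ballEmdist/= gt_max.
  by move=> [-> ->].
by move=> /andP[].
Qed.

HB.instance Definition _ := PseudoMetric_isMetric.Build R (T * U)%type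
  prod_mdist_ge0 prod_mdist_positivity prod_ballEmdist.

End product_metric.

HB.instance Definition _ d d' (R : realFieldType) (T : metricMeasurableType d R)
  (U : metricMeasurableType d' R) := Metric.on (T * U)%type.

(* The witness of nonemptiness is only there to provide the default point that
   the library requires of a measurable space. *)
Definition subspace_of (R : realType) (m : nat) (A : set 'rV[R]_m)
  (_ : A !=set0) : Type := set_type A.

Section subspace_of.
Context (R : realType) (m : nat) (A : set 'rV[R]_m) (A0 : A !=set0).
Local Notation S := (subspace_of A0).

HB.instance Definition _ := PseudoMetric.copy S (set_type A).

Let subspace_point : S := exist _ (sval (cid A0)) (mem_set (svalP (cid A0))).

HB.instance Definition _ := isPointed.Build S subspace_point.

(* The norm is the library's one on matrices, that is, the sup norm. *)
Definition subspace_mdist (x y : S) : R :=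
  `|(set_val x : 'rV[R]_m) - set_val y|.

Let subspace_mdist_ge0 x y : 0 <= subspace_mdist x y.
Proof. exact: normr_ge0. Qed.

Let subspace_mdist_positivity x y : subspace_mdist x y = 0 -> x = y.
Proof.
move/normr0_eq0/eqP; rewrite subr_eq0 => /eqP xy.
by apply: val_inj; move: xy; rewrite set_valE.
Qed.

Let subspace_ballEmdist (x : S) e : ball x e = [set y | subspace_mdist x y < e].
Proof.
rewrite [LHS](_ : _ = set_val @^-1` ball (set_val x : 'rV[R]_m) e)//.
by rewrite -ball_normE.
Qed.

HB.instance Definition _ := PseudoMetric_isMetric.Build R S
  subspace_mdist_ge0 subspace_mdist_positivity subspace_ballEmdist.

HB.instance Definition _ :=
  Measurable.copy S (g_sigma_algebraType (open : set (set S))).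

Lemma subspace_of_borel : borel_space S. Proof. by []. Qed.

End subspace_of.

Section weak_topology.
Context d (R : realType) (T : metricMeasurableType d R).

Definition bounded_continuous : set (T -> R) :=
  [set f | continuous f /\ bounded_fun f].

Definition eval_bounded_continuous (mu : probability T R) :
    {ptws (set_type bounded_continuous) -> R} :=
  fun f => Rintegral mu setT (set_val f).

Definition weak_probability : Type := initial_topology eval_bounded_continuous.

HB.instance Definition _ := Topological.copy weak_probability
  (initial_topology eval_bounded_continuous).

Definition weak_cvg (mu_ : nat -> probability T R) (mu : probability T R) :=
  (mu_ : nat -> weak_probability) @ \oo --> (mu : weak_probability).

End weak_topology.
Arguments weak_probability {d R} T.

Section wasserstein.
Local Open Scope ereal_scope.
Context d (R : realType) (T : metricMeasurableType d R).
Implicit Types mu nu : probability T R.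

Definition coupling mu nu : set (probability (T * T)%type R) :=
  [set g | forall U, measurable U ->
    g (U `*` setT) = mu U /\ g (setT `*` U) = nu U].

Definition wasserstein1 mu nu : \bar R :=
  ereal_inf [set \int[g]_z (mdist z.1 z.2)%:E | g in coupling mu nu].

End wasserstein.

Section joint_law.
Local Open Scope ereal_scope.
Context d d' (R : realType) (X : measurableType d) (A : measurableType d').
Variables (pi : R.-pker X ~> A) (mu : probability X R).

Definition joint_fun (U : set (X * A)) : \bar R := \int[mu]_x pi x (xsection U x).

Let joint0 : joint_fun set0 = 0.
Proof. by apply: integral0_eq => x _; rewrite xsection0 measure0. Qed.

Let joint_ge0 U : 0 <= joint_fun U.
Proof. by apply: integral_ge0 => x _. Qed.

Let joint_additive : semi_sigma_additive joint_fun.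
Proof.
move=> F mF tF mUF.
rewrite [X in _ --> X](_ : _ = \sum_(n <oo) joint_fun (F n)).
  by apply/cvg_closeP; split => //; apply: is_cvg_nneseries => n _ _.
rewrite -integral_nneseries//; last first.
  by move=> n; apply: measurable_fun_xsection_finite_kernel; rewrite inE.
apply: eq_integral => x _; apply/esym/cvg_lim => //=; rewrite xsection_bigcup.
apply: (measure_sigma_additive _ (trivIset_xsection tF)) => n.
exact: measurable_xsection.
Qed.

HB.instance Definition _ := isMeasure.Build _ (X * A)%type R joint_fun
  joint0 joint_ge0 joint_additive.

Let joint_setT : joint_fun setT = 1.
Proof.
rewrite /joint_fun (eq_integral (cst 1)) => [|x _].
  by rewrite integral_cst//= mul1e probability_setT.
by rewrite xsectionE [_ @^-1` _](_ : _ = setT) ?prob_kernel.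
Qed.

HB.instance Definition _ :=
  Measure_isProbability.Build _ (X * A)%type R joint_fun joint_setT.

Definition joint : probability (X * A)%type R := joint_fun.

End joint_law.

(* [Some T] is the horizon T, with times 0, ..., T - 1; [None] is the infinite
   horizon. Flows are indexed by [nat] and only their values at times within
   the horizon matter. *)
Definition within_horizon (h : option nat) (t : nat) : bool :=
  if h is Some T then (t < T)%N else true.

Section mean_field_game.
Local Open Scope ereal_scope.
Context d d' (R : realType) (X : metricMeasurableType d R)
  (A : metricMeasurableType d' R).
Variables (beta : R) (c : X -> A -> probability X R -> R)
  (p : X -> A -> probability X R -> probability X R).

Definition policy_flow := nat -> R.-pker X ~> A.
Definition measure_flow := nat -> probability X R.

Section process.
Context d'' (Omega : measurableType d'') (P : probability Omega R).
Variables (x : nat -> {mfun Omega >-> X}) (a : nat -> {mfun Omega >-> A}).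

Definition history (B : nat -> set X) (C : nat -> set A) (t : nat)
    : set Omega :=
  [set w | forall s, (s < t)%N -> B s (x s w) /\ C s (a s w)].

(* The conditional laws of a_t given (x_0, a_0, ..., x_t) and of x_(t+1) given
   (x_0, a_0, ..., x_t, a_t), tested on the measurable rectangles, which
   generate the history. *)
Record controlled_process (h : option nat) (mu0 : probability X R)
    (pi : policy_flow) (mu : measure_flow) : Prop := {
  controlled_init : forall B, measurable B -> P (x 0%N @^-1` B) = mu0 B ;
  controlled_action : forall t, within_horizon h t -> forall B C,
    (forall s, measurable (B s)) -> (forall s, measurable (C s)) ->
    P (history B C t.+1) =
      \int[P]_(w in history B C t `&` x t @^-1` B t) pi t (x t w) (C t) ;
  controlled_state : forall t, within_horizon h t.+1 -> forall B C,
    (forall s, measurable (B s)) -> (forall s, measurable (C s)) ->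
    P (history B C t.+1 `&` x t.+1 @^-1` B t.+1) =
      \int[P]_(w in history B C t.+1) p (x t w) (a t w) (mu t) (B t.+1) }.

Definition discounted_cost (h : option nat) (mu : measure_flow) (w : Omega)
    : R :=
  let stage t := (beta ^+ t * c (x t w) (a t w) (mu t))%R in
  if h is Some T then (\sum_(t < T) stage t)%R else limn (series stage).

End process.

(* The law of a controlled process is determined by its initial law, its
   policy and the measure flow, so that there is at most one such J. *)
Definition expected_cost (h : option nat) (mu0 : probability X R)
    (mu : measure_flow) (pi : policy_flow) (J : \bar R) : Prop :=
  exists d'' (Omega : measurableType d'') (P : probability Omega R)
    (x : nat -> {mfun Omega >-> X}) (a : nat -> {mfun Omega >-> A}),
    controlled_process P x a h mu0 pi mu /\
    J = 'E_P[discounted_cost x a h mu].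

Definition optimal_policy (h : option nat) (mu0 : probability X R)
    (mu : measure_flow) (pi : policy_flow) : Prop :=
  exists2 J, expected_cost h mu0 mu pi J &
    forall pi' J', expected_cost h mu0 mu pi' J' -> J <= J'.

(* Measures of the library also take values on nonmeasurable sets, whence
   equations on measurable sets instead of equalities of measures. *)
Definition mean_field_equilibrium (h : option nat) (mu0 : probability X R)
    (pi : policy_flow) (mu : measure_flow) : Prop :=
  [/\ forall U, measurable U -> mu 0%N U = mu0 U,
      optimal_policy h mu0 mu pi
    & forall t, within_horizon h t.+1 -> forall U, measurable U ->
        mu t.+1 U = \int[mu t]_x \int[pi t x]_a p x a (mu t) U].

Definition stationary_equilibrium (pi : R.-pker X ~> A)
    (mu : probability X R) : Prop :=
  mean_field_equilibrium None mu (fun=> pi) (fun=> mu).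

Definition asymptotically_discount_optimal (mu0 : probability X R)
    (pi : policy_flow) (mu : measure_flow) : Prop :=
  mean_field_equilibrium None mu0 pi mu /\
  exists pi_oo mu_oo, stationary_equilibrium pi_oo mu_oo /\
    wasserstein1 (joint (pi t) (mu t)) (joint pi_oo mu_oo) @[t --> \oo] --> 0.

End mean_field_game.

Definition extended_flow (S : Type) (T : nat) (f : nat -> S) : nat -> S :=
  fun t => if (t < T)%N then f t else f T.-1.

(* Main.v *)
(* W_1 is compared with integrals of finitely many Lipschitz functions, which
   avoids its triangle inequality (and hence the gluing of couplings). Let
   phi_1, ..., phi_n be a Lipschitz partition of unity by functions supported
   in sets of diameter at most delta. If the integrals of all phi_i against mu
   and nu are close, then a coupling with density
   sum_ij w_ij phi_i(x) phi_j(y) with respect to mu x nu, whose weights w_ij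
   are concentrated on the diagonal, gives W_1(mu, nu) <= delta + small.
   These integrals are Lipschitz for W_1 and continuous for the weak topology.
   So, along the limit flow, they are eventually constant up to a small error,
   and at one such time those of the T-horizon flows are as close as required
   for T large. *)
Require Import Defs.
From HB Require Import structures.
From mathcomp Require Import all_boot all_order all_algebra.
From mathcomp Require Import all_classical all_reals all_analysis.
From mathcomp Require Import finmap measurable_realfun ring lra.

Import Order.TTheory GRing.Theory Num.Theory.
Import numFieldNormedType.Exports.

Local Open Scope classical_set_scope.
Local Open Scope ring_scope.

(* The library's ge0_le_integral requires measurability, which mdist may lack on
   T * T. *)
Lemma ge0_le_integral_nonmeasurable {d} {T : measurableType d} {R : realType}
    (mu : {measure set T -> \bar R}) (f g : T -> \bar R) :
  (forall x, 0 <= f x)%E -> (forall x, f x <= g x)%E ->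
  (\int[mu]_x f x <= \int[mu]_x g x)%E.
Proof.
move=> f0 fg; have g0 x : (0 <= g x)%E := le_trans (f0 x) (fg x).
rewrite !ge0_integralTE//; apply: le_ereal_sup => _ [h hf <-].
by exists h => // x; exact: le_trans (hf x) (fg x).
Qed.

(** * Couplings given by a density with respect to a product measure *)

Section density.
Local Open Scope ereal_scope.
Context {d} {T : measurableType d} {R : realType}.
Variables (m : {measure set T -> \bar R}) (h : T -> R).
Hypothesis mh : measurable_fun setT h.
Hypothesis h0 : forall z, (0 <= h z)%R.
Hypothesis h1 : \int[m]_z (h z)%:E = 1.

(* The unused arguments make the instances below depend on the hypotheses. *)
Let dens (_ : measurable_fun setT h) (_ : forall z, (0 <= h z)%R)
  (_ : \int[m]_z (h z)%:E = 1) (U : set T) := \int[m]_(z in U) (h z)%:E.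
Local Notation g := (dens mh h0 h1).

Let g_set0 : g set0 = 0. Proof. exact: integral_set0. Qed.

Let g_ge0 U : 0 <= g U.
Proof. by apply: integral_ge0 => z _; rewrite lee_fin. Qed.

Let g_additive : semi_sigma_additive g.
Proof.
apply: semi_sigma_additive_nng_induced => [|z]; last by rewrite lee_fin.
exact/measurable_EFinP.
Qed.

HB.instance Definition _ := isMeasure.Build _ T R g g_set0 g_ge0 g_additive.

Let g_setT : g setT = 1. Proof. exact: h1. Qed.

HB.instance Definition _ := Measure_isProbability.Build _ T R g g_setT.

Lemma density_probability :
  exists P : probability T R, forall U, P U = \int[m]_(z in U) (h z)%:E.
Proof. by exists g. Qed.

End density.

Section density_coupling.
Local Open Scope ereal_scope.
Context {d} {R : realType} {T : metricMeasurableType d R}.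
Variables (mu nu : probability T R) (h : T * T -> R).
Hypothesis mh : measurable_fun setT h.
Hypothesis h0 : forall z, (0 <= h z)%R.
Hypothesis hmu : forall y, \int[mu]_x (h (x, y))%:E = 1.
Hypothesis hnu : forall x, \int[nu]_y (h (x, y))%:E = 1.

(** By Tonelli, integrating [h] over one variable leaves the constant 1, so a cylinder over [U] gets
    the marginal mass of [U]. *)
Lemma density_coupling : exists2 g, coupling mu nu g &
  forall U, g U = \int[mu \x nu]_(z in U) (h z)%:E.
Proof.
have mh' : measurable_fun setT (EFin \o h) by exact/measurable_EFinP.
have h0' z : 0 <= (EFin \o h) z by rewrite lee_fin.
have h1 : \int[mu \x nu]_z (h z)%:E = 1.
  rewrite (fubini_tonelli1 (EFin \o h))//.
  under eq_integral do rewrite /fubini_F/= hnu.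
  by rewrite integral_cst//= mul1e; exact: probability_setT.
have [g gE] := @density_probability _ _ _ (mu \x nu) h mh h0 h1.
exists g => // U mU; rewrite !gE; split.
- rewrite integral_mkcond (fubini_tonelli1 ((EFin \o h) \_ (U `*` setT))).
  + transitivity (\int[mu]_x (\1_U x)%:E).
      2: by rewrite integral_indic// setIT.
    apply: eq_integral => x _; rewrite /fubini_F indicE.
    have [xU|xU] := boolP (x \in U).
      rewrite -(hnu x); apply: eq_integral => y _.
      by rewrite patchE mem_set//=; split => //; exact: set_mem.
    rewrite integral0_eq// => y _; rewrite patchE memNset//= => -[+ _].
    by rewrite notin_setE in xU.
  + apply/(measurable_restrictT _ _).1; first exact: measurableX.
    exact: measurable_funTS.
  + by move=> z; apply: erestrict_ge0.
- rewrite integral_mkcond (fubini_tonelli2 ((EFin \o h) \_ (setT `*` U))).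
  + transitivity (\int[nu]_x (\1_U x)%:E).
      2: by rewrite integral_indic// setIT.
    apply: eq_integral => x _; rewrite /fubini_G indicE.
    have [xU|xU] := boolP (x \in U).
      rewrite -(hmu x); apply: eq_integral => y _.
      by rewrite patchE mem_set//=; split => //; exact: set_mem.
    rewrite integral0_eq// => y _; rewrite patchE memNset//= => -[_].
    by rewrite notin_setE in xU.
  + apply/(measurable_restrictT _ _).1; first exact: measurableX.
    exact: measurable_funTS.
  + by move=> z; apply: erestrict_ge0.
Qed.

End density_coupling.

(** * Partitions of unity and the kernels they generate *)

Section partition_of_unity.
Context {d} {R : realType} {T : metricMeasurableType d R}.
Context {n : nat} (phi : 'I_n -> T -> R).

Definition partition_of_unity : Prop :=
  [/\ forall i, measurable_fun setT (phi i), forall i x, 0 <= phi i x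
    & forall x, \sum_i phi i x = 1].

Hypothesis phi_unity : partition_of_unity.

Let mphi i : measurable_fun setT (phi i). Proof. by case: phi_unity. Qed.
Let phi_ge0 i x : 0 <= phi i x. Proof. by case: phi_unity. Qed.
Let phi_sum x : \sum_i phi i x = 1. Proof. by case: phi_unity. Qed.

Lemma partition_of_unity_le1 i x : phi i x <= 1.
Proof.
by rewrite -(phi_sum x) (bigD1 i)//= lerDl sumr_ge0// => j _; exact: phi_ge0.
Qed.

Lemma integral_partition (mu : probability T R) (c : 'I_n -> R) :
  (forall i, 0 <= c i) ->
  (\int[mu]_x (\sum_i c i * phi i x)%:E =
   (\sum_i c i * \int[mu]_x phi i x)%:E)%E.
Proof.
move=> c0.
have int_phi i : (\int[mu]_x (phi i x)%:E = (\int[mu]_x phi i x)%R%:E)%E.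
  rewrite fineK// ge0_fin_numE.
    apply: (@le_lt_trans _ _ 1%E); last by rewrite ltry.
    rewrite -(@probability_setT _ _ _ mu) -[leRHS]mul1e -integral_cst//.
    apply: ge0_le_integral_nonmeasurable => x; rewrite lee_fin.
      exact: phi_ge0.
    exact: partition_of_unity_le1.
  by apply: integral_ge0 => x _; rewrite lee_fin.
under eq_integral do rewrite -sumEFin.
rewrite ge0_integral_sum//.
- rewrite -sumEFin; apply: eq_bigr => i _.
  under eq_integral do rewrite EFinM.
  rewrite ge0_integralZl_EFin//; first by rewrite int_phi EFinM.
  - by move=> x _; rewrite lee_fin.
  - exact/measurable_EFinP.
- by move=> i; apply/measurable_EFinP; apply: measurable_funM.
- by move=> i x _; rewrite lee_fin mulr_ge0.
Qed.

Lemma sum_integral_partition (mu : probability T R) :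
  \sum_i \int[mu]_x phi i x = 1.
Proof.
apply: EFin_inj.
have /= := @integral_partition mu (fun=> 1) (fun=> ler01).
under eq_bigr do rewrite mul1r; move=> <-.
under eq_integral.
  by move=> x _; under eq_bigr do rewrite mul1r; rewrite phi_sum; over.
by rewrite integral_cst//= mul1e; exact: probability_setT.
Qed.

(** Meant as a density with respect to [mu \x nu]: [w i j] weights the mass sent from the support of
    [phi i] to that of [phi j]. *)
Definition partition_kernel (w : 'I_n -> 'I_n -> R) (z : T * T) : R :=
  \sum_i \sum_j w i j * (phi i z.1 * phi j z.2).

Lemma measurable_partition_kernel w : measurable_fun setT (partition_kernel w).
Proof.
apply: measurable_sum => i; apply: measurable_sum => j.
apply: measurable_funM => //; apply: measurable_funM.
  exact: measurableT_comp (mphi i) measurable_fst.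
exact: measurableT_comp (mphi j) measurable_snd.
Qed.

Variables (mu nu : probability T R) (w : 'I_n -> 'I_n -> R).
Hypothesis w_ge0 : forall i j, 0 <= w i j.
Let a i := \int[mu]_x phi i x.
Let b i := \int[nu]_x phi i x.

Lemma partition_kernel_ge0 z : 0 <= partition_kernel w z.
Proof.
by apply: sumr_ge0 => i _; apply: sumr_ge0 => j _; rewrite !mulr_ge0.
Qed.

(** If all the coefficients of the [phi i] on the right are 1, the result is 1; this is the marginal
    condition of [density_coupling]. *)
Lemma integral_partition_kernelr x :
  (\int[nu]_y (partition_kernel w (x, y))%:E =
   (\sum_i (\sum_j w i j * b j) * phi i x)%:E)%E.
Proof.
under eq_integral.
  move=> y _; rewrite /partition_kernel/= exchange_big/=.
  under eq_bigr.
    by move=> j _; under eq_bigr do rewrite mulrA; rewrite -mulr_suml; over.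
  over.
rewrite integral_partition; last first.
  by move=> j; apply: sumr_ge0 => i _; rewrite mulr_ge0.
congr EFin; under [RHS]eq_bigr do rewrite mulr_suml.
rewrite [RHS]exchange_big/=; apply: eq_bigr => j _.
by rewrite mulr_suml; apply: eq_bigr => i _; rewrite mulrAC.
Qed.

Lemma integral_partition_kernell y :
  (\int[mu]_x (partition_kernel w (x, y))%:E =
   (\sum_j (\sum_i w i j * a i) * phi j y)%:E)%E.
Proof.
under eq_integral.
  move=> x _; rewrite /partition_kernel/=.
  under eq_bigr.
    move=> i _; under eq_bigr do rewrite mulrCA mulrC.
    by rewrite -mulr_suml; over.
  over.
rewrite integral_partition; last first.
  by move=> i; apply: sumr_ge0 => j _; rewrite mulr_ge0.
congr EFin; under [RHS]eq_bigr do rewrite mulr_suml.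
rewrite [RHS]exchange_big/=; apply: eq_bigr => i _.
by rewrite mulr_suml; apply: eq_bigr => j _; rewrite mulrAC.
Qed.

(** Stated for arbitrary nonnegative weights so that it applies to coupling weights whose diagonal
    has been set to zero. *)
Lemma integral_partition_kernel :
  (\int[mu \x nu]_z (partition_kernel w z)%:E =
   (\sum_i \sum_j w i j * (a i * b j))%:E)%E.
Proof.
rewrite (fubini_tonelli1 (EFin \o partition_kernel w))/=; last 2 first.
  by apply/measurable_EFinP; exact: measurable_partition_kernel.
  by move=> z; rewrite lee_fin partition_kernel_ge0.
rewrite /fubini_F/=; under eq_integral do rewrite integral_partition_kernelr.
rewrite integral_partition; last first.
  by move=> i; apply: sumr_ge0 => j _; rewrite mulr_ge0// Rintegral_ge0.
congr EFin; apply: eq_bigr => i _; rewrite mulr_suml.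
by apply: eq_bigr => j _; rewrite -mulrA [b j * _]mulrC.
Qed.

End partition_of_unity.

(** * Upper bounds for W_1 from weights on a partition of unity *)

(** The kernel of [w] is the density of a coupling [g]. Off the set [far], some [phi i] is positive
    at both coordinates, whose distance is then at most [delta]; on [far] the distance is at most
    [D], and the off-diagonal terms bound the [g]-mass of [far]. *)
Lemma wasserstein1_partition {d} {R : realType} {T : metricMeasurableType d R}
    {n} {phi : 'I_n -> T -> R} {mu nu : probability T R}
    {w : 'I_n -> 'I_n -> R} {delta D : R} :
  partition_of_unity phi -> (forall i j, 0 <= w i j) ->
  (forall j, \sum_i w i j * \int[mu]_x phi i x = 1) ->
  (forall i, \sum_j w i j * \int[nu]_x phi j x = 1) ->
  0 <= delta -> 0 <= D -> (forall x y : T, mdist x y <= D) ->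
  (forall i x y, 0 < phi i x -> 0 < phi i y -> mdist x y <= delta) ->
  (wasserstein1 mu nu <= (delta + D * \sum_i \sum_(j | j != i)
     w i j * (\int[mu]_x phi i x * \int[nu]_x phi j x))%:E)%E.
Proof.
move=> phi1 w0 wmu wnu delta0 D0 ltD close.
have [mphi phi0 phi_sum] := phi1.
have [||g cg gE] := @density_coupling _ _ _ mu nu (partition_kernel phi w)
  (measurable_partition_kernel _ phi1 w) (partition_kernel_ge0 _ phi1 _ w0).
- move=> y; rewrite integral_partition_kernell//.
  by under eq_bigr do rewrite wmu mul1r; rewrite phi_sum.
- move=> x; rewrite integral_partition_kernelr//.
  by under eq_bigr do rewrite wnu mul1r; rewrite phi_sum.
have prod_ge0 (z : T * T) i : 0 <= phi i z.1 * phi i z.2 by rewrite mulr_ge0.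
(* At a point of [far] every diagonal term of the kernel vanishes. *)
pose far := (fun z : T * T => \sum_i phi i z.1 * phi i z.2) @^-1` [set 0].
have mfar : measurable far.
  rewrite -[far]setTI; apply: measurable_sum => //.
  move=> i; apply: measurable_funM.
    exact: measurableT_comp (mphi i) measurable_fst.
  exact: measurableT_comp (mphi i) measurable_snd.
have nearP z : ~ far z -> mdist z.1 z.2 <= delta.
  move=> /(psumr_neq0P (fun i _ => prod_ge0 z i))[i /= phiz].
  have : phi i z.1 * phi i z.2 != 0 by rewrite gt_eqF.
  by rewrite mulf_eq0 negb_or => /andP[z1 z2]; apply: (close i);
    rewrite lt_neqAle eq_sym ?z1 ?z2 phi0.
(* On [far] the weights [v] and [w] give the same kernel, so the mass of [far] is at most the full
   integral of the kernel of [v]. *)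
pose v i j := if j != i then w i j else 0.
have v0 i j : 0 <= v i j by rewrite /v; case: ifP.
apply: (@le_trans _ _ (\int[g]_z (mdist z.1 z.2)%:E)%E).
  by apply: ereal_inf_lbound; exists g.
apply: (@le_trans _ _ (\int[g]_z (delta%:E + D%:E * (\1_far z)%:E))%E).
  apply: ge0_le_integral_nonmeasurable => z; first by rewrite lee_fin mdist_ge0.
  rewrite -EFinM -EFinD lee_fin indicE.
  have [zf|zf] := boolP (z \in far); first by rewrite mulr1 ler_wpDl.
  by rewrite mulr0 addr0 nearP//; rewrite notin_setE in zf.
rewrite ge0_integralD//=; last 2 first.
- by move=> z _; rewrite mule_ge0// lee_fin.
- by apply: measurable_funeM; exact/measurable_EFinP/measurable_indic.
rewrite integral_cst//= ge0_integralZl_EFin//; last first.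
  exact/measurable_EFinP/measurable_indic.
rewrite integral_indic// setIT.
have -> : g setT = 1%E by exact: probability_setT.
rewrite [X in (_ + _ * X)%E](gE far).
rewrite mule1 EFinD leeD2l// EFinM lee_wpmul2l//.
under [in leRHS]eq_bigr do rewrite big_mkcond/=.
rewrite [leRHS](_ : _ = (\sum_i \sum_j v i j *
   (\int[mu]_x phi i x * \int[nu]_x phi j x))%:E); last first.
  congr EFin; apply: eq_bigr => i _; apply: eq_bigr => j _.
  by rewrite /v; case: ifP => //; rewrite mul0r.
rewrite -integral_partition_kernel// integral_mkcond.
apply: ge0_le_integral_nonmeasurable => z.
  by apply: erestrict_ge0 => y _; rewrite lee_fin partition_kernel_ge0.
rewrite patchE; case: ifPn => [zf|_].
  2: by rewrite lee_fin partition_kernel_ge0.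
rewrite lee_fin; apply: ler_sum => i _; apply: ler_sum => j _.
rewrite /v; case: ifPn => // /negPn/eqP ->; rewrite mul0r.
have /psumr_eq0P-> // := set_mem zf; first by rewrite mulr0.
Qed.

Lemma transport_weights {R : realType} {n} {a b : 'I_n -> R} {e : R} :
  (forall i, 0 <= a i) -> (forall i, 0 <= b i) ->
  \sum_i a i = 1 -> \sum_i b i = 1 -> 0 < e -> e < 1 ->
  exists w : 'I_n -> 'I_n -> R,
    [/\ forall i j, 0 <= w i j, forall j, \sum_i w i j * a i = 1,
        forall i, \sum_j w i j * b j = 1 &
        \sum_i \sum_(j | j != i) w i j * (a i * b j) <=
          e + \sum_i `|a i - b i|].
Proof.
move=> a0 b0 a1 b1 e0 e1.
(* The diagonal part keeps (1 - e) min(a_i, b_i) of the mass in place, and the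
   residual masses are coupled independently; e > 0 makes their total rho
   nonzero. If a_i = b_i = 0, then k i is 0. *)
pose k i := (1 - e) / Num.max (a i) (b i).
have max0 i : 0 <= Num.max (a i) (b i) by rewrite le_max a0.
have k0 i : 0 <= k i by rewrite divr_ge0// subr_ge0 ltW.
have frac (x y : R) : 0 <= x -> x <= y -> x / y <= 1.
  move=> x0 xy; have [->|y0] := eqVneq y 0; first by rewrite invr0 mulr0.
  by rewrite ler_pdivrMr ?mul1r// lt_neqAle eq_sym y0 (le_trans x0).
have ka i : k i * a i <= 1 - e.
  rewrite /k mulrAC -mulrA ler_piMr ?subr_ge0 ?(ltW e1)// frac//.
  by rewrite le_max lexx.
have kb i : k i * b i <= 1 - e.
  rewrite /k mulrAC -mulrA ler_piMr ?subr_ge0 ?(ltW e1)// frac//.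
  by rewrite le_max lexx orbT.
pose rho := 1 - \sum_i k i * a i * b i.
have rhoE : rho = \sum_i (1 - k i * a i) * b i.
  by under eq_bigr do rewrite mulrBl mul1r; rewrite sumrB b1.
have rhoE' : rho = \sum_i (1 - k i * b i) * a i.
  under eq_bigr do rewrite mulrBl mul1r; rewrite sumrB a1.
  by congr (_ - _); apply: eq_bigr => i _; rewrite mulrAC.
have eE : e = \sum_i e * b i by rewrite -mulr_sumr b1 mulr1.
have rho_gt0 : 0 < rho.
  apply: (lt_le_trans e0); rewrite rhoE eE.
  by apply: ler_sum => i _; rewrite ler_wpM2r//; have := ka i; lra.
have rho_le : rho <= e + \sum_i `|a i - b i|.
  rewrite rhoE eE -big_split/=.
  apply: ler_sum => i _.
  (* The quotient by the maximum is the minimum of [a i] and [b i], so the last bracket is the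
     positive part of [b i - a i]. *)
  have -> : (1 - k i * a i) * b i =
      e * b i + (1 - e) * (b i - a i * b i / Num.max (a i) (b i)).
    by rewrite /k; ring.
  rewrite lerD2l -[leRHS]mul1r.
  apply: ler_pM; rewrite ?subr_ge0 ?gerBl ?(ltW e0) ?(ltW e1)//.
    rewrite -mulrA mulrCA.
    by rewrite ler_piMr// frac// le_max lexx.
  have [ba|ab] := leP (b i) (a i).
    have [ai0|ai0] := eqVneq (a i) 0.
      have -> : b i = 0 by apply/le_anti; rewrite b0 -ai0 ba.
      by rewrite mulr0 mul0r subrr.
    by rewrite mulrAC mulfV// mul1r subrr.
  by rewrite mulfK ?gt_eqF ?(le_lt_trans (a0 i))// ler_normr opprB lexx orbT.
(* The residual masses are [r i * a i] and [q j * b j], each of total [rho]; their independent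
   coupling, divided by [a i * b j], is the second term of [w]. *)
pose r i := 1 - k i * b i; pose q j := 1 - k j * a j.
have r0 i : 0 <= r i by rewrite subr_ge0 (le_trans (kb i))// gerBl ltW.
have q0 i : 0 <= q i by rewrite subr_ge0 (le_trans (ka i))// gerBl ltW.
pose w i j := (i == j)%:R * k i + rho^-1 * (r i * q j).
exists w; split.
- move=> i j; rewrite addr_ge0// mulr_ge0 ?k0// ?mulr_ge0 ?r0 ?q0//.
  by rewrite invr_ge0 ltW.
- move=> j; rewrite /w; under eq_bigr do rewrite mulrDl.
  rewrite big_split/= (bigD1 j)//= eqxx mul1r big1 ?addr0; last first.
    by move=> i /negbTE ->; rewrite !mul0r.
  under eq_bigr do rewrite [r _ * _]mulrC -!mulrA.
  by rewrite -!mulr_sumr -rhoE' mulrCA mulVf ?gt_eqF// /q mulr1 addrC subrK.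
- move=> i; rewrite /w; under eq_bigr do rewrite mulrDl.
  rewrite big_split/= (bigD1 i)//= eqxx mul1r big1 ?addr0; last first.
    by move=> j; rewrite eq_sym => /negbTE ->; rewrite !mul0r.
  under eq_bigr do rewrite -!mulrA.
  by rewrite -!mulr_sumr -rhoE mulrCA mulVf ?gt_eqF// /r mulr1 addrC subrK.
- apply: le_trans rho_le.
  (* Off the diagonal only the independent part remains; adding its diagonal terms completes it to
     its total mass [rho]. *)
  rewrite [leRHS](_ : _ = rho^-1 * (rho * rho)); last first.
    by rewrite mulKf// gt_eqF.
  rewrite {2}rhoE' {2}rhoE mulr_suml mulr_sumr; apply: ler_sum => i _.
  rewrite [leRHS]mulrA mulr_sumr big_mkcond/=; apply: ler_sum => j _.
  case: ifPn => [ji|_]; last first.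
    by rewrite !mulr_ge0// ?invr_ge0 ?(ltW rho_gt0)//; [exact: r0|exact: q0].
  rewrite /w eq_sym (negbTE ji) mul0r add0r le_eqVlt; apply/orP; left.
  by apply/eqP; rewrite /r /q; ring.
Qed.

(** * Lower bound for W_1 by Lipschitz test functions *)

Lemma Rintegral_marginal {d d'} {T : measurableType d} {U : measurableType d'}
    {R : realType} {mu : probability T R} {g : probability U R} {p : U -> T}
    {phi : T -> R} :
  measurable_fun setT p -> measurable_fun setT phi -> bounded_fun phi ->
  (forall B, measurable B -> g (p @^-1` B) = mu B) ->
  \int[mu]_x phi x = \int[g]_z phi (p z) /\
  g.-integrable setT (EFin \o (phi \o p)).
Proof.
move=> mp mphi bphi gp.
have iphi : g.-integrable setT (EFin \o (phi \o p)).
  apply: measurable_bounded_integrable => //.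
  - by rewrite [X in (X < _)%E](@probability_setT _ _ _ g) ltry.
  - exact: measurableT_comp.
  - case: bphi => M [Mr phiM]; exists M; split => // K MK z _.
    by apply: phiM => //.
split=> //; congr fine; transitivity (\int[pushforward g p]_x (phi x)%:E)%E.
  by apply: eq_measure_integral => B mB _; exact: esym (gp B mB).
rewrite integral_pushforward//; exact/measurable_EFinP.
Qed.

(** The easy half of Kantorovich-Rubinstein duality: both integrals are taken against one coupling,
    and the Lipschitz bound is used under the integral. *)
Lemma le_Rintegral_wasserstein1 {d} {R : realType}
    {T : metricMeasurableType d R} (mu nu : probability T R) (phi : T -> R)
    (L : R) :
  measurable_fun setT phi -> bounded_fun phi -> 0 < L ->
  (forall x y, `|phi x - phi y| <= L * mdist x y) ->
  ((L^-1 * `|\int[mu]_x phi x - \int[nu]_x phi x|)%:E <= wasserstein1 mu nu)%E.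
Proof.
move=> mphi bphi L0 phiL; apply: le_ereal_inf_tmp => _ [g cg <-].
have g1 B : measurable B -> g (fst @^-1` B) = mu B.
  by move=> /cg[<- _]; rewrite setXT.
have g2 B : measurable B -> g (snd @^-1` B) = nu B.
  by move=> /cg[_ <-]; rewrite setTX.
have [-> i1] := Rintegral_marginal measurable_fst mphi bphi g1.
have [-> i2] := Rintegral_marginal measurable_snd mphi bphi g2.
have i12 : g.-integrable setT (EFin \o (fun z => phi z.1 - phi z.2)).
  exact: (integrableB measurableT i1 i2).
rewrite -RintegralB//.
apply: (@le_trans _ _ (L^-1 * \int[g]_z `|phi z.1 - phi z.2|)%:E).
  by rewrite lee_fin ler_pM2l ?invr_gt0// le_normr_Rintegral.
rewrite -RintegralZl//; last exact: integrable_norm.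
rewrite fineK; last first.
  apply: integrable_fin_num => //.
  apply: (integrableZl measurableT L^-1 (integrable_norm i12)).
apply: ge0_le_integral_nonmeasurable => z; rewrite lee_fin.
  by rewrite mulr_ge0// invr_ge0 ltW.
by rewrite ler_pdivrMl.
Qed.

(** * Finite nets and Lipschitz partitions of unity on a compact space *)

Lemma compact_finite_net {d} {R : realType} {T : metricMeasurableType d R}
    {e : R} :
  compact [set: T] -> 0 < e ->
  exists n (u : 'I_n -> T), forall x, exists i, mdist (u i) x < e.
Proof.
rewrite compact_cover => cT e0.
have [||s _ cov] := cT T setT (fun x => (ball x e)°).
- by move=> x _; exact: open_interior.
- by move=> x _; exists x => //; exact: nbhsx_ballx.
exists (size (enum_fset s)), (tnth (in_tuple (enum_fset s))) => x.
have [y /= ys /interior_subset] := cov x Logic.I.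
rewrite ballEmdist/= => yx; have /seq_tnthP[i yE] : y \in enum_fset s by [].
by exists i; rewrite -yE.
Qed.

Lemma compact_diameter {d} {R : realType} {T : metricMeasurableType d R} :
  compact [set: T] -> exists2 D : R, 0 <= D & forall x y : T, mdist x y <= D.
Proof.
move=> /(@compact_finite_net _ _ _ 1)[//|n [u net]].
have s0 : 0 <= \sum_i \sum_j mdist (u i) (u j).
  by do 2 (apply: sumr_ge0 => ? _); exact: mdist_ge0.
(* Each of the two points is within 1 of the net, and the sum bounds every distance inside the
   net. *)
exists (2 + \sum_i \sum_j mdist (u i) (u j)); first by rewrite addr_ge0.
move=> x y; have [i /ltW ix] := net x; have [j /ltW jy] := net y.
have uij : mdist (u i) (u j) <= \sum_i \sum_j mdist (u i) (u j).
  rewrite (bigD1 i)//= (bigD1 j)//= -addrA lerDl addr_ge0//.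
    by apply: sumr_ge0 => k _; exact: mdist_ge0.
  by do 2 (apply: sumr_ge0 => ? _); exact: mdist_ge0.
have := metric_triangle x (u i) y; have := metric_triangle (u i) (u j) y.
rewrite [mdist x (u i)]metric_sym; lra.
Qed.

Lemma lipschitz_continuous_fun {R : realType} {T : metricType R} {f : T -> R}
    {L : R} :
  0 < L -> (forall x y, `|f x - f y| <= L * mdist x y) -> continuous f.
Proof.
move=> L0 fL x; apply/cvgrPdist_lt => e e0; apply/nbhs_ballP.
exists (e / L); first by rewrite /= divr_gt0.
move=> y; rewrite ballEmdist/= ltr_pdivlMr// mulrC; exact: le_lt_trans.
Qed.

Lemma mdist_lipschitz {R : realType} {T : metricType R} (u x y : T) :
  `|mdist u x - mdist u y| <= mdist x y.
Proof.
have := metric_triangle u x y; have := metric_triangle u y x.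
by rewrite (metric_sym y) ler_norml => ? ?; apply/andP; split; lra.
Qed.

Lemma borel_measurable_mdist {d} {R : realType} {T : metricMeasurableType d R}
    (u : T) : borel_space T -> measurable_fun setT (mdist u).
Proof.
move=> borelT; apply: (measurability _ (RGenOpens.measurableE R)).
move=> _ [_ [a [b ->]] <-]; rewrite setTI borelT; apply: sub_sigma_algebra.
apply: open_comp; last exact: interval_open.
move=> x _; apply: (@lipschitz_continuous_fun _ _ _ 1) => // y z.
by rewrite mul1r mdist_lipschitz.
Qed.

(** Tent functions of radius [delta / 2] around the points of a finite net are divided by their sum.
    The net has half that mesh, which bounds the sum away from 0. *)
Lemma lipschitz_partition_of_unity {d} {R : realType}
    {T : metricMeasurableType d R} {delta : R} :
  compact [set: T] -> (forall u : T, measurable_fun setT (mdist u)) ->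
  0 < delta ->
  exists n (phi : 'I_n -> T -> R) (L : R), [/\ partition_of_unity phi, 0 < L,
    forall i x y, `|phi i x - phi i y| <= L * mdist x y &
    forall i x y, 0 < phi i x -> 0 < phi i y -> mdist x y <= delta].
Proof.
move=> cT mT delta0; pose r := delta / 2; have r0 : 0 < r by rewrite divr_gt0.
have [//||n [u net]] := @compact_finite_net _ R T (r / 2).
  by rewrite divr_gt0.
pose f i x := Num.max 0 (r - mdist (u i) x).
have f0 i x : 0 <= f i x by rewrite le_max lexx.
have fL i x y : `|f i x - f i y| <= mdist x y.
  have := mdist_lipschitz (u i) x y; have := mdist_ge0 x y; rewrite /f.
  rewrite !ler_norml => ? /andP[? ?]; apply/andP.
  by case: (leP 0 (r - mdist (u i) x)); case: (leP 0 (r - mdist (u i) y));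
    split; lra.
pose S x := \sum_i f i x.
have fS i x : f i x <= S x.
  by rewrite /S (bigD1 i)//= lerDl sumr_ge0// => j _; exact: f0.
have Sr x : r / 2 <= S x.
  have [i ix] := net x; apply: le_trans (fS i x).
  rewrite le_max [X in _ <= X - _](splitr r) -addrA lerDl subr_ge0.
  by rewrite (ltW ix) orbT.
have S0 x : 0 < S x by apply: lt_le_trans (Sr x); rewrite divr_gt0.
have SL x y : `|S x - S y| <= n%:R * mdist x y.
  rewrite /S -sumrB (le_trans (ler_norm_sum _ _ _))//.
  rewrite -[X in X%:R](card_ord n) mulr_natl -sumr_const.
  exact: ler_sum.
have mf i : measurable_fun setT (f i).
  apply: measurable_maxr => //; exact: measurable_funB.
have mS : measurable_fun setT S by exact: measurable_sum.
(* The numerator is 1-Lipschitz, [S] is [n]-Lipschitz, and [2 / r] bounds the inverse of [S]. *)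
exists n, (fun i x => f i x / S x), ((1 + n%:R) * (2 / r)); split.
- split => [i|i x|x]; last by rewrite -mulr_suml divff// gt_eqF//; exact: S0.
  + apply: measurable_funM => //.
    rewrite (_ : (fun x => (S x)^-1) = (fun x => powR (S x) (-1))).
      exact: (measurableT_comp (@measurable_powR R (-1)) mS).
    by apply/funext => x; rewrite powR_inv1// ltW.
  + by rewrite divr_ge0// ltW.
- by rewrite mulr_gt0// divr_gt0.
- move=> i x y.
  (* In this form only the quotient [f i y / S y], at most 1, multiplies the variation of [S]. *)
  have -> : f i x / S x - f i y / S y =
      (f i x - f i y + f i y / S y * (S y - S x)) / S x.
    by field; rewrite !gt_eqF.
  have S'0 z : 0 <= (S z)^-1 by rewrite invr_ge0 ltW.
  rewrite normrM [X in _ * X <= _]ger0_norm//.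
  rewrite -[leRHS]mulrA [2 / r * _]mulrC mulrA; apply: ler_pM => //.
  + rewrite mulrDl mul1r (le_trans (ler_normD _ _))// lerD// normrM.
    rewrite distrC -[leRHS]mul1r; apply: ler_pM => //.
    rewrite ger0_norm ?divr_ge0 ?(ltW (S0 y))//.
    by rewrite ler_pdivrMr// mul1r.
  + by rewrite -invf_div lef_pV2 ?posrE// divr_gt0.
- have near i x : 0 < f i x / S x -> mdist (u i) x < r.
    by rewrite pmulr_lgt0 ?invr_gt0// lt_max ltxx/= subr_gt0.
  move=> i x y /near ix /near iy.
  apply: (le_trans (metric_triangle x (u i) y)); rewrite metric_sym.
  by rewrite (splitr delta) ltW// ltrD.
Qed.

(** * Control of W_1 by finitely many integrals *)

Lemma wasserstein1_partition_of_unity {d} {R : realType}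
    {T : metricMeasurableType d R} {eps : R} :
  compact [set: T] -> (forall u : T, measurable_fun setT (mdist u)) ->
  0 < eps ->
  exists n (phi : 'I_n -> T -> R) (L eta : R), [/\ partition_of_unity phi,
    0 < L, 0 < eta, forall i x y, `|phi i x - phi i y| <= L * mdist x y &
    forall mu nu : probability T R,
      (forall i, `|\int[mu]_x phi i x - \int[nu]_x phi i x| < eta) ->
      (wasserstein1 mu nu < eps%:E)%E].
Proof.
move=> cT mT eps0; have [D D0 leD] := compact_diameter cT.
have delta0 : 0 < eps / 4 by rewrite divr_gt0.
have [n [phi [L [phi1 L0 phiL close]]]] :=
  lipschitz_partition_of_unity cT mT delta0.
have D1 : 0 < D + 1 by rewrite ltr_wpDl.
(* The bound on W_1 has three terms, each at most [eps / 4]: the diameter [delta], [D * e], and [D]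
   times a sum of [n] differences below [eta]. Using [D + 1] and [n.+1] keeps the denominator
   positive. *)
exists n, phi, L, (eps / (4 * (D + 1) * n.+1%:R)); split=> //.
  by rewrite divr_gt0// !mulr_gt0.
(* The summand [eps] in the denominator forces [e < 1], the other one [D * e <= eps / 4]. *)
move=> mu nu munu; pose e := eps / (4 * (D + 1) + eps).
have den0 : 0 < 4 * (D + 1) + eps by rewrite addr_gt0// mulr_gt0.
have e0 : 0 < e by rewrite divr_gt0.
have e1 : e < 1 by rewrite ltr_pdivrMr// mul1r ltrDr mulr_gt0.
have De : D * e <= eps / 4.
  rewrite /e mulrA ler_pdivrMr//; have := ltW (mulr_gt0 eps0 eps0); lra.
have [_ phi_ge0 _] := phi1.
have int_ge0 (la : probability T R) i : 0 <= \int[la]_x phi i x.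
  by apply: Rintegral_ge0 => x _.
have [w [w0 wmu wnu wle]] := transport_weights (int_ge0 mu) (int_ge0 nu)
  (sum_integral_partition _ phi1 mu) (sum_integral_partition _ phi1 nu) e0 e1.
apply: (le_lt_trans (wasserstein1_partition phi1 w0 wmu wnu
  (ltW delta0) D0 leD close)).
rewrite lte_fin.
apply: (@le_lt_trans _ _ (eps / 4 + (eps / 4 + eps / 4))); last lra.
rewrite lerD2l (le_trans (ler_wpM2l D0 wle))// mulrDr lerD//.
apply: (@le_trans _ _ (D * (\sum_(i < n) eps / (4 * (D + 1) * n.+1%:R)))).
  by rewrite ler_wpM2l//; apply: ler_sum => i _; exact/ltW.
rewrite sumr_const card_ord -[_ *+ n]mulr_natr.
have -> : D * (eps / (4 * (D + 1) * n.+1%:R) * n%:R) =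
    eps / 4 * (D / (D + 1) * (n%:R / n.+1%:R)).
  by field; rewrite !gt_eqF.
rewrite ler_piMr ?(ltW delta0)// mulr_ile1 ?divr_ge0 ?(ltW D1)//.
  by rewrite ler_pdivrMr// mul1r lerDl.
by rewrite ler_pdivrMr// mul1r ler_nat.
Qed.

(** * From convergence at each time to approximation of the tail *)

(** The integrals of each [phi i] against [N t] and [M k s] differ by three errors below [eta / 3]:
    from [N t] to [P], from [P] to [N s], and from [N s] to [M k s]. The first is uniform in [t]. *)
Lemma wasserstein1_diagonal {d} {R : realType} {T : metricMeasurableType d R}
    {M : nat -> nat -> probability T R} {N : nat -> probability T R}
    {P : probability T R} {eps : R} :
  compact [set: T] -> (forall u : T, measurable_fun setT (mdist u)) ->
  (forall t (f : T -> R), continuous f -> bounded_fun f ->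
    \int[M k t]_x f x @[k --> \oo] --> \int[N t]_x f x) ->
  wasserstein1 (N t) P @[t --> \oo] --> 0%E -> 0 < eps ->
  exists s k t0, (0 < k)%N /\
    forall t, (t0 <= t)%N -> (wasserstein1 (M k s) (N t) < eps%:E)%E.
Proof.
move=> cT mT MN NP eps0.
have [n [phi [L [eta [phi1 L0 eta0 phiL close]]]]] :=
  wasserstein1_partition_of_unity cT mT eps0.
have [mphi phi_ge0 _] := phi1.
have bphi i : bounded_fun (phi i).
  exists 1; split => // K K1 x _; rewrite /= ger0_norm//.
  exact: le_trans (partition_of_unity_le1 _ phi1 i x) (ltW K1).
have e3 : 0 < eta / 3 by rewrite divr_gt0.
have /NP[t0 _ Nt0] :
    nbhs 0%E [set y : \bar R | (y < (L^-1 * (eta / 3))%:E)%E].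
  apply: open_nbhs_nbhs; split; first exact: open_ereal_lt_ereal.
  by rewrite /= lte_fin mulr_gt0// invr_gt0.
have NPphi t i : (t0 <= t)%N ->
    `|\int[N t]_x phi i x - \int[P]_x phi i x| < eta / 3.
  move=> /Nt0; rewrite -(ltr_pM2l (_ : 0 < L^-1)) ?invr_gt0// -lte_fin.
  exact/le_lt_trans/le_Rintegral_wasserstein1.
have [k _ Mk] : \forall k \near \oo, forall i,
    `|\int[N t0]_x phi i x - \int[M k t0]_x phi i x| < eta / 3.
  apply: filter_forall => i; apply: cvgr_dist_lt e3.
  by apply: MN => //; exact: lipschitz_continuous_fun L0 (phiL i).
(* [t0] is both the time of the approximant and the start of the tail; the successor of [k] makes
   the index positive. *)
exists t0, k.+1, t0; split => // t /NPphi Nt; apply: close => i.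
have {}Mk := Mk k.+1 (leqnSn k).
have := Mk i; have := Nt i; have := NPphi t0 i (leqnn _).
rewrite !ltr_norml => /andP[? ?] /andP[? ?] /andP[? ?].
by apply/andP; split; lra.
Qed.

Lemma weak_cvg_Rintegral {d} {R : realType} {T : metricMeasurableType d R}
    {mu_ : nat -> probability T R} {mu : probability T R} (f : T -> R) :
  weak_cvg mu_ mu -> continuous f -> bounded_fun f ->
  \int[mu_ k]_x f x @[k --> \oo] --> \int[mu]_x f x.
Proof.
move=> cmu cf bf.
have fcb : bounded_continuous f by split.
have ev_mu := cvg_comp _ _ cmu (@initial_continuous _ _ _ mu).
exact: (cvg_comp _ _ ev_mu (@proj_continuous _ _ (exist _ f (mem_set fcb)) _)).
Qed.

(** A filter is pushed forward to the ambient space, where it clusters at a point of [A]; balls of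
    the subspace are traces of ambient balls. *)
Lemma compact_subspace_of {R : realType} {m : nat} {A : set 'rV[R]_m}
    (A0 : A !=set0) : compact A -> compact [set: subspace_of A0].
Proof.
move=> cA F FF FT; pose v (x : subspace_of A0) : 'rV[R]_m := set_val x.
have [|a [Aa Fa]] := cA (v @ F) _.
  apply: (@filterS _ F _ setT (v @^-1` A)) FT => x _.
  exact: set_mem (svalP x).
exists (exist _ a (mem_set Aa)); split=> // U V FU /nbhs_ballP[e /= e0 eV].
have [_ [[x Ux <-]] ax] : (v @` U `&` ball a e) !=set0.
  apply: Fa; last exact: nbhsx_ballx.
  by apply: (@filterS _ F _ U (v @^-1` (v @` U))) FU => x Ux; exists x.
by exists x; split => //; exact: eV.
Qed.

(** The distance to a fixed pair is a maximum of two one-coordinate distances, which gives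
    measurability for the product sigma-algebra. *)
Lemma measurable_mdist_pair {d d'} {R : realType}
    {X : metricMeasurableType d R} {Y : metricMeasurableType d' R} :
  borel_space X -> borel_space Y ->
  forall u : X * Y, measurable_fun setT (mdist u).
Proof.
move=> bX bY u; apply: measurable_maxr.
  exact: measurableT_comp (borel_measurable_mdist _ bX) measurable_fst.
exact: measurableT_comp (borel_measurable_mdist _ bY) measurable_snd.
Qed.

(** * Approximation of the limit flow's tail by extended equilibria *)

Theorem proposition3 (R : realType)
  (d : measure_display) (X : metricMeasurableType d R)
  (compactX : compact [set: X]) (borelX : borel_space X)
  (m : nat) (A : set 'rV[R]_m) (A0 : A !=set0)
  (compactA : compact A) (convexA : convex_set A)
  (beta : R) (beta_ge0 : 0 <= beta) (beta_lt1 : beta < 1)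
  (c : X -> subspace_of A0 -> probability X R -> R)
  (p : X -> subspace_of A0 -> probability X R -> probability X R)
  (mu0 : probability X R)
  (c_continuous : forall (x_ : nat -> X) (a_ : nat -> subspace_of A0)
     (mu_ : nat -> probability X R) x a mu,
     x_ @ \oo --> x -> a_ @ \oo --> a -> weak_cvg mu_ mu ->
     c (x_ n) (a_ n) (mu_ n) @[n --> \oo] --> c x a mu)
  (p_continuous : forall (x_ : nat -> X) (a_ : nat -> subspace_of A0)
     (mu_ : nat -> probability X R) x a mu,
     x_ @ \oo --> x -> a_ @ \oo --> a -> weak_cvg mu_ mu ->
     weak_cvg (fun n => p (x_ n) (a_ n) (mu_ n)) (p x a mu))
  (L1 K1 : R)
  (c_lipschitz : forall x y a mu,
     `|c x a mu - c y a mu| <= L1 * mdist x y)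
  (p_lipschitz : forall x y a mu,
     (wasserstein1 (p x a mu) (p y a mu) <= (K1 * mdist x y)%:E)%E)
  (betaK1 : beta * K1 < 1)
  (piT : nat -> policy_flow X (subspace_of A0))
  (muT : nat -> measure_flow X)
  (equilibriumT : forall T, (0 < T)%N ->
     mean_field_equilibrium beta c p (Some T) mu0 (piT T) (muT T))
  (pihat : policy_flow X (subspace_of A0)) (muhat : measure_flow X)
  (adohat : asymptotically_discount_optimal beta c p mu0 pihat muhat)
  (cvgT :
     (fun T t => joint (extended_flow T (piT T) t) (extended_flow T (muT T) t))
       @ \oo -->
     ((fun t => joint (pihat t) (muhat t)) :
       {ptws nat -> weak_probability (X * subspace_of A0)%type})) :
  (forall eps : R, 0 < eps ->
     exists ttilde Ttilde Teps : nat, (0 < Ttilde)%N /\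
       forall t, (Teps <= t)%N ->
         (wasserstein1
            (joint (extended_flow Ttilde (piT Ttilde) ttilde)
                   (extended_flow Ttilde (muT Ttilde) ttilde))
            (joint (pihat t) (muhat t)) < eps%:E)%E)
  /\
  (forall eps : R, 0 < eps ->
     exists2 rho : probability (X * subspace_of A0)%type R,
       [set rho | exists T s, (0 < T)%N /\
          rho = joint (extended_flow T (piT T) s) (extended_flow T (muT T) s)]
         rho &
       exists N, (ereal_sup [set wasserstein1 rho (joint (pihat t) (muhat t))
                            | t in [set t | (N <= t)%N]] < eps%:E)%E).
Proof.
have cXA : compact [set: X * subspace_of A0].
  by rewrite -setXTT; apply: compact_setX => //; exact: compact_subspace_of.
have mXA := measurable_mdist_pair borelX (subspace_of_borel A0).
have [_ [pi_oo [mu_oo [_ cvg_oo]]]] := adohat.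
have approx (eps : R) : 0 < eps -> exists s T t0 : nat, (0 < T)%N /\
    forall t, (t0 <= t)%N ->
      (wasserstein1 (joint (extended_flow T (piT T) s)
                           (extended_flow T (muT T) s))
                    (joint (pihat t) (muhat t)) < eps%:E)%E.
  apply: (@wasserstein1_diagonal _ _ _ (fun T s =>
    joint (extended_flow T (piT T) s) (extended_flow T (muT T) s)) _
    _ _ cXA mXA _ cvg_oo) => t f.
  apply: weak_cvg_Rintegral.
  (* Convergence in the product topology is projected to the single time [t]. *)
  exact: (cvg_comp _ _ cvgT (@proj_continuous _ _ t _)).
split=> [|eps eps0]; first exact: approx.
(* A supremum of values below [eps / 2] is at most [eps / 2], hence strictly below [eps]. *)
have [s [T [N [T0 close]]]] := approx _ (divr_gt0 eps0 (ltr0n R 2)).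
exists (joint (extended_flow T (piT T) s) (extended_flow T (muT T) s)).
  by exists T, s.
exists N; apply: (@le_lt_trans _ _ (eps / 2)%:E).
  by apply: ge_ereal_sup => _ [t Nt <-]; exact/ltW/close.
by rewrite lte_fin gtr_pMr// invf_lt1// ltr1n.
Qed.
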